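(* Let $T=(V,E)$ be a tree which is not a path. Then $$edim(T)=dim(T)=\sum_{v\in V,\ l_v>1}(l_v-1),$$ where $l_v$ denotes the number of legs at $v$.
   Context: All graphs are finite and simple. Let $T=(V,E)$ be a tree and $v\in V$. Define the equivalence relation $R_v$ on $E$ by: $e\,R_v\,f$ if and only if there is a path in $T$ including $e$ and $f$ that does not have $v$ as an internal vertex. The subgraphs induced by the edges of the equivalence classes of $E$ are called the bridges of $T$ relative to $v$. The legs at $v$ are the bridges of $T$ relative to $v$ which are paths, and $l_v$ is the number of legs at $v$. For a connected graph $G=(V,E)$, $d_G(x,y)$ is the length of a shortest path between vertices $x,y$. A vertex $v$ distinguishes two vertices $x,y$ if $d_G(v,x)\neq d_G(v,y)$. A set $S\subseteq V$ is a metric generator for $G$ if any two distinct vertices of $G$ are distinguished by some element of $S$; the metric dimension $dim(G)$ is the minimum cardinality of a metric generator. The distance between a vertex $v$ and an edge $e=uw$ is $d_G(e,v)=\min\{d_G(u,v),d_G(w,v)\}$. A vertex $w$ distinguishes two edges $e_1,e_2$ if $d_G(w,e_1)\ne d_G(w,e_2)$. A set $S\subseteq V$ is an edge metric generator for $G$ if every two distinct edges of $G$ are distinguished by some vertex of $S$; the edge metric dimension $edim(G)$ is the smallest cardinality of an edge metric generator for $G$. *)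

(* Defs.v *)
From mathcomp Require Import all_boot.

Set Implicit Arguments.
Unset Strict Implicit.
Unset Printing Implicit Defensive.

(* A finite simple graph on the vertex type T is a symmetric irreflexive
   relation e; an edge is the two-element set of its end vertices. *)

Definition simple_graph (T : finType) (e : rel T) : Prop :=
  symmetric e /\ irreflexive e.

Definition edges (T : finType) (e : rel T) : {set {set T}} :=
  [set A | [exists x, [exists y, e x y && (A == [set x; y])]]].

Definition connected_graph (T : finType) (e : rel T) : Prop :=
  0 < #|T| /\ forall x y, connect e x y.

(* For a simple graph, a cyclic sequence of distinct vertices is a graph cycle
   exactly when it has at least three vertices. *)
Definition acyclic_graph (T : finType) (e : rel T) : Prop :=
  forall s : seq T, ucycle e s -> size s <= 2.

Definition tree (T : finType) (e : rel T) : Prop :=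
  [/\ simple_graph e, connected_graph e & acyclic_graph e].

(* A path is the sequence of its (distinct) vertices. *)

Definition simple_path (T : finType) (e : rel T) (s : seq T) : bool :=
  sorted e s && uniq s.

Definition path_edges (T : finType) (s : seq T) : seq {set T} :=
  [seq [set a.1; a.2] | a <- zip s (behead s)].

Definition internal_vertices (T : finType) (s : seq T) : seq T :=
  if s is x :: p then behead (belast x p) else [::].

(* The graph with vertex set V and edge set E is a path (with at least one
   vertex); a duplicate-free listing of V has length #|V|. *)
Definition is_path_graph (T : finType) (V : {set T}) (E : {set {set T}}) : bool :=
  (V != set0) &&
  [exists s : #|V|.-tuple T,
     [&& uniq s, [set x in s] == V & [set A in path_edges s] == E]].

Lemma is_path_graphP (T : finType) (V : {set T}) (E : {set {set T}}) :
  reflect (exists s : seq T, [/\ s != [::], uniq s, [set x in s] = V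
                               & [set A in path_edges s] = E])
          (is_path_graph V E).
Proof.
apply: (iffP andP) => [[V0 /existsP[s /and3P[us /eqP sV /eqP sE]]]|].
  exists s; split=> //.
  by rewrite -size_eq0 size_tuple cards_eq0.
case=> s [s0 us sV sE]; split.
  rewrite -sV; case: s s0 {us sV sE} => // x s _.
  by apply/set0Pn; exists x; rewrite !inE eqxx.
have sz : size s == #|V| by rewrite -sV cardsE; apply/eqP/esym/card_uniqP.
by apply/existsP; exists (Tuple sz); rewrite /= us sV sE !eqxx.
Qed.

(* The relation R_v: some path includes both edges A and B and does not have v
   as an internal vertex.  Boundedness of the length makes it decidable. *)
Definition same_bridge (T : finType) (e : rel T) (v : T) : rel {set T} :=
  fun A B => [exists n : 'I_#|T|.+1, [exists s : n.-tuple T,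
    [&& simple_path e s, A \in path_edges s, B \in path_edges s
      & v \notin internal_vertices s]]].

Lemma same_bridgeP (T : finType) (e : rel T) (v : T) (A B : {set T}) :
  reflect (exists s : seq T, [/\ simple_path e s, A \in path_edges s,
             B \in path_edges s & v \notin internal_vertices s])
          (same_bridge e v A B).
Proof.
apply: (iffP existsP) => [[n /existsP[s /and4P[]]]|[s [ps sA sB sv]]].
  by exists s.
have sz : size s < #|T|.+1.
  by have /andP[_ /card_uniqP <-] := ps; apply: max_card.
exists (Ordinal sz); apply/existsP; exists (in_tuple s).
exact/and4P.
Qed.

(* A bridge is represented by its edge set; its vertices are those covered. *)
Definition bridges (T : finType) (e : rel T) (v : T) : {set {set {set T}}} :=
  equivalence_partition (same_bridge e v) (edges e).

Definition legs (T : finType) (e : rel T) (v : T) : {set {set {set T}}} :=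
  [set B in bridges e v | is_path_graph (cover B) B].

Definition num_legs (T : finType) (e : rel T) (v : T) : nat := #|legs e v|.

(* A path has fewer than #|T| edges, so the default value #|T| of the minimum
   is only attained when no path joins x to y. *)
Definition gdist (T : finType) (e : rel T) (x y : T) : nat :=
  \big[minn/#|T|]_(n < #|T| | [exists p : n.-tuple T,
      [&& path e x p, uniq (x :: p) & last x p == y]]) n.

Lemma gdist_le_card (T : finType) (e : rel T) (x y : T) : gdist e x y <= #|T|.
Proof.
rewrite /gdist; elim/big_rec: _ => // n m _ le_m.
by rewrite geq_min le_m orbT.
Qed.

Lemma big_minn_le (I : finType) (d : nat) (P : pred I) (F : I -> nat) (i : I) :
  P i -> \big[minn/d]_(j | P j) F j <= F i.
Proof.
move=> Pi; have := mem_index_enum i.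
elim: (index_enum I) => // j r IH; rewrite inE big_cons => /orP[/eqP <-|/IH le].
  by rewrite Pi geq_minl.
by case: ifP => // _; rewrite geq_min le orbT.
Qed.

Lemma gdist_le (T : finType) (e : rel T) (x : T) (p : seq T) :
  path e x p -> uniq (x :: p) -> gdist e x (last x p) <= size p.
Proof.
move=> ep up.
have sz : size p < #|T| by have := max_card (mem (x :: p)); rewrite (card_uniqP up).
apply: (@big_minn_le _ _ _ (fun n : 'I_#|T| => n : nat) (Ordinal sz)).
by apply/existsP; exists (in_tuple p); rewrite /= ep -/(uniq (x :: p)) up eqxx.
Qed.

Lemma gdist_path (T : finType) (e : rel T) (x y : T) :
  connect e x y -> exists p : seq T,
    [/\ path e x p, uniq (x :: p), last x p = y & size p = gdist e x y].
Proof.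
case/connectP=> q /shortenP[p ep up _] ->.
have sz : gdist e x (last x p) < #|T|.
  apply: leq_ltn_trans (gdist_le ep up) _.
  by have := max_card (mem (x :: p)); rewrite (card_uniqP up).
move: sz; rewrite /gdist; elim/big_rec: _ => [|n m /existsP[r]].
  by rewrite ltnn.
move=> /and3P[er ur /eqP lr] IH; rewrite /minn; case: ifP => _ // _.
by exists r; rewrite size_tuple.
Qed.

Lemma gdist_eq0 (T : finType) (e : rel T) (x y : T) :
  connect e x y -> (gdist e x y == 0) = (x == y).
Proof.
move=> cxy; apply/eqP/eqP => [d0|<-].
  by have [p [_ _ lp]] := gdist_path cxy; rewrite d0 -lp => /size0nil->.
by apply/eqP; rewrite -leqn0; apply: (@gdist_le _ e x [::]).
Qed.

Definition metric_generator (T : finType) (e : rel T) (S : {set T}) : bool :=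
  [forall x, forall y, (x != y) ==> [exists v in S, gdist e v x != gdist e v y]].

Lemma metric_generatorT (T : finType) (e : rel T) :
  connected_graph e -> metric_generator e [set: T].
Proof.
case=> _ ce; apply/forallP=> x; apply/forallP=> y; apply/implyP=> xy.
apply/exists_inP; exists x; rewrite ?inE //.
have /eqP-> : gdist e x x == 0 by rewrite gdist_eq0.
by rewrite eq_sym gdist_eq0.
Qed.

Definition metric_dim (T : finType) (e : rel T) : nat :=
  #|[arg min_(S < [set: T] | metric_generator e S) #|S| ]|.

(* The distance from v to the edge A = [set u; w] is the minimum of the
   distances to u and to w. *)
Definition edge_dist (T : finType) (e : rel T) (v : T) (A : {set T}) : nat :=
  \big[minn/#|T|]_(u in A) gdist e v u.

Lemma edge_dist2 (T : finType) (e : rel T) (v u w : T) :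
  edge_dist e v [set u; w] = minn (gdist e v u) (gdist e v w).
Proof.
apply/eqP; rewrite eqn_leq leq_min !big_minn_le ?inE ?eqxx ?orbT //=.
apply: (big_ind (fun n => minn (gdist e v u) (gdist e v w) <= n)).
- by rewrite geq_min gdist_le_card.
- by move=> m n le_m le_n; rewrite leq_min le_m.
- by move=> z; rewrite !inE => /orP[] /eqP->; rewrite ?geq_minl ?geq_minr.
Qed.

Definition edge_metric_generator (T : finType) (e : rel T) (S : {set T}) : bool :=
  [forall A in edges e, forall B in edges e,
     (A != B) ==> [exists v in S, edge_dist e v A != edge_dist e v B]].

Lemma edge_metric_generatorT (T : finType) (e : rel T) :
  simple_graph e -> connected_graph e -> edge_metric_generator e [set: T].
Proof.
case=> _ irr [_ ce].
have d0 v u w : (edge_dist e v [set u; w] == 0) = (v \in [set u; w]).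
  by rewrite edge_dist2 -leqn0 geq_min !leqn0 !gdist_eq0 // !inE.
have E A : A \in edges e -> exists u w, u != w /\ A = [set u; w].
  rewrite inE => /existsP[u /existsP[w /andP[euw /eqP->]]]; exists u, w.
  by split=> //; apply: contraTneq euw => ->; rewrite irr.
apply/forall_inP=> A /E[u [w [uw ->]]]; apply/forall_inP=> B /E[x [y [xy ->]]].
apply/implyP; apply: contraR => /exists_inP noS.
rewrite eqEcard !cards2 uw xy leqnn andbT.
apply/subsetP=> z; apply: contraTT => zB; apply/negP=> zA; apply: noS.
exists z; rewrite ?inE //; move: zA zB; rewrite -!d0 => /eqP->.
by rewrite eq_sym.
Qed.

Definition edge_metric_dim (T : finType) (e : rel T) : nat :=
  #|[arg min_(S < [set: T] | edge_metric_generator e S) #|S| ]|.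

(* Main.v *)
Require Import Defs.
From mathcomp Require Import all_boot zify.

Set Implicit Arguments.
Unset Strict Implicit.
Unset Printing Implicit Defensive.

(** For a vertex v of a tree and a neighbour a of v, the branch at v through a
    is the set of vertices closer to a than to v; the branches at v partition
    the other vertices, and adding v with its edges turns them into the bridges
    at v.

    Both dimensions are governed by one combinatorial condition.  Along a simple
    path, the distance from a fixed vertex s changes by one at every step and
    has no interior peak, since a vertex has at most one neighbour closer to s;
    so it is V-shaped ([gdist_V_shape]).  Hence s fails to distinguish the two
    end vertices of the path, or its two end edges, only if the bottom of the V
    is exactly in the middle of the path, that is, the path has a middle vertex
    and s lies in neither of the two branches there that the path enters
    ([middle_branch]).  Any two vertices are the ends of a simple path, and any
    two edges are its first and last edges ([edges_path]).  Conversely, two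
    neighbours a, b of v, and the edges va and vb, are equidistant from every s
    outside the branches through a and b.  Therefore, in a tree which is not a
    path, S is a metric generator iff it is an edge metric generator iff for
    every v it misses at most one branch at v ([metric_generatorP],
    [edge_metric_generatorP]).  The two dimensions are the minimum size of such
    a set S.

    The bridge at v through a is a path iff all vertices of the branch have
    degree at most 2 ([leg_is_path_graph]), so l_v counts the neighbours of v
    with this property.  A set S as above meets at least l_v - 1 of the legs at
    v away from v.  When l_v > 1 the vertex v has degree at least 3, because the
    tree is not a path, and therefore legs at different such vertices are
    disjoint away from their origins ([legs_disjoint]); summing gives the lower
    bound ([hits_lower_bound]).  For the upper bound, let S consist of all but
    one of the neighbours of v lying on legs at v, for each v with l_v > 1.  A
    branch which is not a leg contains an outermost vertex of degree at least 3;
    two or more legs leave that vertex outwards, and S meets one of them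
    ([chosen_hits_nonleg]).  So S misses at most one branch at every vertex, and
    it has at most as many elements as the sum ([chosen_card]). *)

(** * Sequences, edges and paths as vertex lists *)

(** A sequence with steps +1 and -1 and no interior peak descends to a single
    lowest position m and climbs afterwards.  With truncated subtraction,
    (i - m) + (m - i) is the absolute difference of i and m. *)
Lemma V_shape (f : nat -> nat) k :
    (forall i, i < k -> f i = (f i.+1).+1 \/ f i.+1 = (f i).+1) ->
    (forall i, i.+1 < k -> ~ (f i < f i.+1 /\ f i.+2 < f i.+1)) ->
  exists2 m, m <= k & forall i, i <= k -> f i = f m + (i - m) + (m - i).
Proof.
elim: k => [|k IH] step nomax.
  by exists 0 => // i; rewrite leqn0 => /eqP->; rewrite !addn0.
have [|i ik|m mk fm] := IH; [by move=> i ik; apply: step; lia|by apply: nomax; lia|].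
have ext m' : m' <= k.+1 -> f k.+1 = f m' + (k.+1 - m') + (m' - k.+1) ->
    (forall i, i <= k -> f i = f m' + (i - m') + (m' - i)) ->
    exists2 m, m <= k.+1 & forall i, i <= k.+1 -> f i = f m + (i - m) + (m - i).
  by move=> m'k fk fi; exists m' => // i; rewrite leq_eqVlt => /orP[/eqP->|] //; apply: fi.
have [up|dn] : f k.+1 = (f k).+1 \/ f k = (f k.+1).+1 by have := step k (ltnSn k); lia.
  by apply: (ext m) => //; [lia|rewrite up (fm k) //; lia].
have mk' : m = k.
  case: (ltngtP m k) mk => // mk _; case: k mk step nomax fm dn {IH ext} => // k mk step nomax fm dn.
  have := nomax k (ltnSn _); have := fm k (leqnSn _); have := fm k.+1 (leqnn _); lia.
apply: (ext k.+1) => //; first by lia.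
by move=> i ik; have := fm i ik; rewrite mk' dn; lia.
Qed.

Lemma path_edgesP (T : finType) (x0 : T) (s : seq T) (A : {set T}) :
  reflect (exists2 i, i.+1 < size s & A = [set nth x0 s i; nth x0 s i.+1])
          (A \in path_edges s).
Proof.
have sz : size (zip s (behead s)) = (size s).-1 by rewrite size_zip size_behead; lia.
apply: (iffP mapP) => [[a /(nthP (x0, x0))[i]]|[i ip ->]].
  rewrite nth_zip_cond sz => lt_i; rewrite lt_i nth_behead => <- ->.
  by exists i => //; lia.
exists (nth (x0, x0) (zip s (behead s)) i).
  by apply: mem_nth; rewrite sz; lia.
by rewrite nth_zip_cond sz nth_behead ifT //=; lia.
Qed.

(** The interior positions of a vertex sequence are 1, ..., size s - 2. *)
Lemma internal_verticesP (T : finType) (x0 : T) (s : seq T) (v : T) :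
  reflect (exists2 i, 0 < i < (size s).-1 & nth x0 s i = v) (v \in internal_vertices s).
Proof.
case: s => [|x p] /=; first by apply: (iffP idP) => // -[i]; lia.
have nthE i : i.+1 < size p -> nth x0 (behead (belast x p)) i = nth x0 p i.
  move=> ip; rewrite nth_behead -[RHS]/(nth x0 (x :: p) i.+1) lastI nth_rcons.
  by rewrite size_belast ip.
have sz : size (behead (belast x p)) = (size p).-1 by rewrite size_behead size_belast.
apply: (iffP (nthP x0)) => -[i]; rewrite ?sz.
  move=> ip <-; have ip' : i.+1 < size p by lia.
  by exists i.+1; rewrite ?nthE.
by case: i => // i /= ip <-; exists i; rewrite ?nthE //; lia.
Qed.

Lemma cover_path_edges (T : finType) (s : seq T) :
  1 < size s -> cover [set A in path_edges s] = [set x in s].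
Proof.
case: s => // x0 s s1; apply/setP=> x; rewrite inE; apply/bigcupP/idP => [[A]|].
  rewrite inE => /(path_edgesP x0)[i si ->].
  by rewrite in_set2 => /orP[] /eqP->; apply: mem_nth => //; apply: ltnW.
case/(nthP x0)=> i si <-; have [si1|si1] := ltnP i.+1 (size (x0 :: s)).
  exists [set nth x0 (x0 :: s) i; nth x0 (x0 :: s) i.+1]; last exact: set21.
  by rewrite inE; apply/(path_edgesP x0); exists i.
case: i si si1 => [|i] si si1; first by move: s1 si1 => /=; lia.
exists [set nth x0 (x0 :: s) i; nth x0 (x0 :: s) i.+1]; last exact: set22.
by rewrite inE; apply/(path_edgesP x0); exists i.
Qed.

(** In a listing without repetition, the partners of x along the path can only
    be the entries just before and just after x. *)
Lemma path_degree (T : finType) (s : seq T) (x : T) :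
  uniq s -> #|[set y | [set x; y] \in path_edges s]| <= 2.
Proof.
move=> us; pose i := index x s.
(* At the ends of s the default value x, or x itself, stands in for the missing
   neighbour; the bound 2 survives. *)
apply: (@leq_trans #|[set nth x s i.-1; nth x s i.+1]|); last by rewrite cards2; case: (_ != _).
apply/subset_leq_card/subsetP=> y; rewrite inE => /(path_edgesP x)[j sj /setP E].
have sj' : j < size s by apply: ltnW.
have nj : (nth x s j == nth x s j.+1) = false by rewrite nth_uniq //; lia.
have := E x; have := E (nth x s j); have := E (nth x s j.+1).
rewrite !in_set2 !eqxx orbT /=.
move=> E1 E2 /esym/orP[] /eqP xj.
  have ij : i = j by rewrite /i {1}xj index_uniq.
  move: E1; rewrite -xj in nj.
  by rewrite eq_sym nj /= => /eqP<-; rewrite ij eqxx orbT.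
have ij : i = j.+1 by rewrite /i {1}xj index_uniq.
move: E2; rewrite -xj in nj.
by rewrite nj /= => /eqP<-; rewrite ij eqxx.
Qed.

Section Tree.

Variables (T : finType) (e : rel T).
Hypothesis treeT : tree e.

Local Notation d := (gdist e).

Definition neighbours (x : T) : {set T} := [set y | e x y].

Lemma tree_sym : symmetric e.
Proof. by case: treeT => -[]. Qed.

Lemma tree_irr : irreflexive e.
Proof. by case: treeT => -[]. Qed.

Lemma tree_connect x y : connect e x y.
Proof. by case: treeT => _ [_ ->]. Qed.

Lemma edge_neq x y : e x y -> x != y.
Proof. by apply: contraTneq => ->; rewrite tree_irr. Qed.

Lemma gdistxx x : d x x = 0.
Proof. by apply/eqP; rewrite gdist_eq0 ?tree_connect. Qed.

Lemma gdist_gt0 x y : x != y -> 0 < d x y.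
Proof. by rewrite lt0n gdist_eq0 ?tree_connect. Qed.

(** * Distances in a tree *)

Lemma gdist_walk x p : path e x p -> d x (last x p) <= size p.
Proof.
case/shortenP=> q eq uq sub; apply: leq_trans (gdist_le eq uq) _.
by apply: uniq_leq_size sub; case/andP: uq.
Qed.

Lemma gdist_sym x y : d x y = d y x.
Proof.
suff le u w : d u w <= d w u by apply/eqP; rewrite eqn_leq !le.
have [p [ep _ <- <-]] := gdist_path (tree_connect w u).
have := gdist_walk (x := last w p) (p := rev (belast w p)).
rewrite size_rev size_belast rev_path (@eq_path _ _ e) => [/(_ ep)|a b]; last exact: tree_sym.
suff -> : last (last w p) (rev (belast w p)) = w by [].
by case: p {ep} => //= z p; rewrite rev_cons last_rcons.
Qed.

Lemma gdist_step x y z : e y z -> d x z <= (d x y).+1.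
Proof.
have [p [ep _ <- <-]] := gdist_path (tree_connect x y) => ez.
by have := @gdist_walk x (rcons p z); rewrite rcons_path ep ez last_rcons size_rcons; apply.
Qed.

Lemma gdist_prev x y : x != y -> exists2 z, e y z & d x y = (d x z).+1.
Proof.
have [p [ep _ <-]] := gdist_path (tree_connect x y).
case/lastP: p ep => [|p z]; first by rewrite eqxx.
rewrite rcons_path last_rcons size_rcons => /andP[ep ez] sz _.
exists (last x p); first by rewrite tree_sym.
by apply/eqP; rewrite eqn_leq gdist_step // -sz ltnS gdist_walk.
Qed.

(** Adjacency in the tree with v deleted. *)
Definition avoid (v : T) : rel T := fun x y => [&& e x y, x != v & y != v].

Lemma avoid_sym v : connect_sym (avoid v).
Proof. by apply: sym_connect_sym => x y; rewrite /avoid tree_sym (andbC (x != v)). Qed.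

(** A simple path from a to b avoiding v would close up through v to a cycle
    with at least three vertices. *)
Lemma neighbours_separated v a b :
  e v a -> e v b -> connect (avoid v) a b -> a = b.
Proof.
move=> eva evb /connectP[q /shortenP[p ep up _] lb]; apply/eqP; apply: contraT => ab.
have pe : path e a p by apply: sub_path ep => x y /and3P[].
have pv : v \notin a :: p.
  rewrite inE negb_or (edge_neq eva) /=; apply/negP=> vp.
  have : all (fun x => x != v) p.
    elim: p a {eva ab up lb pe vp} ep => //= y p IH x /andP[/and3P[_ _ ->]] /=.
    exact: IH.
  by move/allP/(_ _ vp); rewrite eqxx.
have : ucycle e (v :: a :: p).
  by rewrite /ucycle /cycle rcons_path [uniq _]cons_uniq pv up /= eva pe -lb tree_sym evb.
case: treeT => _ _ /[apply] /=.
by case: p lb {ep up pe pv} ab => //= ->; rewrite eqxx.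
Qed.

(** Along a geodesic from a to s the distance to s decreases strictly, so only
    its first vertex could be as far from s as v; the geodesic avoids v. *)
Lemma closer_connect v a s : a != v -> d s a <= d s v -> connect (avoid v) a s.
Proof.
have [n] := ubnP (d s a); elim: n a => // n IH a; rewrite ltnS => le_n av le_v.
case: (eqVneq s a) => [->|sa]; first exact: connect0.
have [z ez dz] := gdist_prev sa.
have zv : z != v by apply: contraTneq le_v => <-; rewrite dz ltnn.
apply: (@connect_trans _ _ z); first by apply: connect1; rewrite /avoid ez av.
by apply: IH => //; lia.
Qed.

Lemma closer_neighbour_unique s v a b :
  e v a -> e v b -> d s a < d s v -> d s b < d s v -> a = b.
Proof.
move=> eva evb da db; apply: (neighbours_separated eva evb).
apply: (@connect_trans _ _ s); last rewrite avoid_sym.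
  by apply: closer_connect; [rewrite eq_sym edge_neq | apply: ltnW].
by apply: closer_connect; [rewrite eq_sym edge_neq | apply: ltnW].
Qed.

(** If v and a were equally far from s, then v would have a neighbour z closer
    to s; both z and a reach s avoiding v, although they are separated by v. *)
Lemma gdist_adj_neq s v a : e v a -> d s v != d s a.
Proof.
move=> eva; apply/eqP=> E.
have av : a != v by rewrite eq_sym edge_neq.
case: (eqVneq s v) => [sv|sv].
  move: E; rewrite -sv gdistxx; have := @gdist_gt0 s a.
  by rewrite sv eq_sym av => /(_ isT); lia.
have [z ez dz] := gdist_prev sv.
suff az : a = z by move: E; rewrite az; lia.
apply: (neighbours_separated eva ez).
apply: (@connect_trans _ _ s); last rewrite avoid_sym.
  by apply: closer_connect => //; lia.
by apply: closer_connect; [rewrite eq_sym edge_neq | lia].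
Qed.

Lemma gdist_adj s v a : e v a -> d s v = (d s a).+1 \/ d s a = (d s v).+1.
Proof.
move=> eva; have := gdist_adj_neq s eva; have := gdist_step s eva.
by rewrite tree_sym in eva; have := gdist_step s eva; lia.
Qed.

(** * Branches *)

Definition branch (v a : T) : {set T} := [set x | d x a < d x v].

Lemma branch_root v a : e v a -> a \in branch v a.
Proof. by move=> eva; rewrite inE gdistxx gdist_gt0 // eq_sym edge_neq. Qed.

Lemma notin_branch v a : v \notin branch v a.
Proof. by rewrite inE gdistxx. Qed.

Lemma notin_branchE s v a : e v a -> s \notin branch v a -> d s a = (d s v).+1.
Proof. by move=> eva; rewrite inE; have := gdist_adj s eva; lia. Qed.

Lemma branch_exists v x : x != v -> exists2 a, e v a & x \in branch v a.
Proof. by move/gdist_prev=> [a eva dx]; exists a; rewrite ?inE ?dx. Qed.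

Lemma branch_unique v a b x :
  e v a -> e v b -> x \in branch v a -> x \in branch v b -> a = b.
Proof. by move=> eva evb; rewrite !inE; apply: closer_neighbour_unique. Qed.

Lemma branchE v a x : e v a -> (x \in branch v a) = connect (avoid v) a x.
Proof.
move=> eva; apply/idP/idP => [xa|].
  apply: closer_connect; first by rewrite eq_sym edge_neq.
  by move: xa; rewrite inE => /ltnW.
move=> cax; have [xv|/branch_exists[b evb xb]] := eqVneq x v.
  move: cax; rewrite avoid_sym xv => /connectP[[|z p] /=].
    by move=> _ av; move: eva; rewrite av tree_irr.
  by rewrite {1}/avoid eqxx andbF.
suff -> : a = b by [].
apply: (neighbours_separated eva evb); apply: connect_trans cax _; rewrite avoid_sym.
by apply: closer_connect; [rewrite eq_sym edge_neq | move: xb; rewrite inE => /ltnW].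
Qed.

(** A branch is a component of the tree with v deleted, hence it can be left only
    through v. *)
Lemma branch_closed v a x y :
  e v a -> e x y -> y != v -> x \in branch v a -> y \in branch v a.
Proof.
move=> eva exy yv xa.
have xv : x != v by apply: contraTneq xa => ->; apply: notin_branch.
move: xa; rewrite !branchE // => cx; apply: connect_trans cx _.
by apply: connect1; rewrite /avoid exy xv.
Qed.

(** This recursive description is what inductions on the size of a branch use:
    the branches at a other than the one towards v are strictly smaller. *)
Lemma branch_rec v a x : e v a ->
  x \in branch v a = (x == a) || [exists b, [&& e a b, b != v & x \in branch a b]].
Proof.
move=> eva; have eav : e a v by rewrite tree_sym.
case: (eqVneq x a) => [->|xa] /=; first exact: branch_root.
apply/idP/existsP => [xv|[b /and3P[eab bv xb]]].
  have [b eab xb] := branch_exists xa; exists b; rewrite eab xb andbT /=.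
  by apply: contraTneq xv => bv; move: xb; rewrite !inE bv; lia.
rewrite inE; case: (gdist_adj x eva) => [->//|dav].
suff bv' : b = v by rewrite bv' eqxx in bv.
by apply: (branch_unique eab eav xb); rewrite inE dav.
Qed.

Lemma branch_sub v a b : e v a -> e a b -> b != v -> branch a b \proper branch v a.
Proof.
move=> eva eab bv; apply/properP; split.
  apply/subsetP=> x xb; rewrite branch_rec //; apply/orP; right.
  by apply/existsP; exists b; rewrite eab bv.
by exists a; [apply: branch_root | apply: notin_branch].
Qed.

(** * Generators and branches *)

(** An interior peak of the distance from s along a simple path would be a vertex
    with two different neighbours closer to s. *)
Lemma gdist_V_shape s x0 p : simple_path e p -> 0 < size p ->
  exists2 m, m < size p & forall i, i < size p ->
    d s (nth x0 p i) = d s (nth x0 p m) + (i - m) + (m - i).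
Proof.
case/andP=> /(sortedP x0) sp up p0.
have [i ik|i ik|m mk fm] := @V_shape (fun i => d s (nth x0 p i)) (size p).-1.
- by apply: gdist_adj; apply: sp; lia.
- have e1 : e (nth x0 p i) (nth x0 p i.+1) by apply: sp; lia.
  have e2 : e (nth x0 p i.+1) (nth x0 p i.+2) by apply: sp; lia.
  have [lt_i lt_i2] : i < size p /\ i.+2 < size p by lia.
  move=> [d1 d2]; rewrite tree_sym in e1.
  have /eqP := closer_neighbour_unique e1 e2 d1 d2.
  by rewrite nth_uniq //; lia.
- by exists m => [|i ip]; [lia | apply: fm; lia].
Qed.

Lemma simple_path_between (x y : T) : exists p : seq T,
  [/\ path e x p, simple_path e (x :: p), last x p = y & size p = d x y].
Proof.
have [p [ep up <- <-]] := gdist_path (tree_connect x y); exists p.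
by split; rewrite // /simple_path up /= ep.
Qed.

(** At every vertex v, at most one branch at v contains no element of S. *)
Definition hits_branches (S : {set T}) : Prop :=
  forall v a b, e v a -> e v b -> a != b ->
    exists2 s, s \in S & (s \in branch v a) || (s \in branch v b).

(** If the path has an odd number of edges, the bottom of the V cannot be in the
    middle, whatever s is.  Otherwise take s in one of the two branches at the
    middle vertex that the path enters: the distance from s decreases from the
    middle into that branch, so the bottom is elsewhere. *)
Lemma middle_branch S x0 p : hits_branches S -> S != set0 ->
    simple_path e p -> 1 < size p ->
  exists2 s, s \in S & exists m, [/\ m < size p,
    forall i, i < size p -> d s (nth x0 p i) = d s (nth x0 p m) + (i - m) + (m - i)
    & m + m != (size p).-1].
Proof.
move=> hS S0 sp p1; have /andP[/(sortedP x0) ep up] := sp.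
case: (boolP (odd (size p))) => [odd_p|even_p]; last first.
  case/set0Pn: S0 => s sS; exists s => //.
  have [|m mp V] := gdist_V_shape s x0 sp; first by lia.
  exists m; split=> //; lia.
(* h is the position of the middle vertex. *)
pose h := (size p).-1./2.
have hE : h + h = (size p).-1 by rewrite /h; lia.
have e1 : e (nth x0 p h) (nth x0 p h.-1).
  by rewrite tree_sym; have := ep h.-1; rewrite prednK; [apply; lia | lia].
have e2 : e (nth x0 p h) (nth x0 p h.+1) by apply: ep; lia.
have [lt_h lt_h2] : h.-1 < size p /\ h.+1 < size p by lia.
have ne : nth x0 p h.-1 != nth x0 p h.+1 by rewrite nth_uniq //; lia.
have [s sS sb] := hS _ _ _ e1 e2 ne; exists s => //.
have [|m mp V] := gdist_V_shape s x0 sp; first by lia.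
exists m; split=> //; apply/eqP => mE; move: sb.
have mh : m = h by lia.
have lt_h0 : h < size p by lia.
by rewrite !inE; have := V _ lt_h; have := V _ lt_h2; have := V _ lt_h0; lia.
Qed.

Lemma edgesP (A : {set T}) :
  reflect (exists x y, e x y /\ A = [set x; y]) (A \in edges e).
Proof.
rewrite inE; apply: (iffP existsP) => [[x /existsP[y /andP[exy /eqP]]]|[x [y [exy ->]]]].
  by exists x, y.
by exists x; apply/existsP; exists y; rewrite exy eqxx.
Qed.

Lemma mem_edges x y : e x y -> [set x; y] \in edges e.
Proof. by move=> exy; apply/edgesP; exists x, y. Qed.

(** If S misses the branches at v through a and b, then the vertices a and b are
    both one step further than v from all of S. *)
Lemma metric_generator_hits S : metric_generator e S -> hits_branches S.
Proof.
move=> /forallP mS v a b eva evb ab; have /forallP/(_ b) := mS a.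
rewrite ab => /exists_inP[s sS dab]; exists s => //.
apply: contraNT dab; rewrite negb_or => /andP[sa sb].
by rewrite !(notin_branchE _ sa, notin_branchE _ sb).
Qed.

(** Here the edges va and vb are both exactly as far as v from all of S. *)
Lemma edge_metric_generator_hits S : edge_metric_generator e S -> hits_branches S.
Proof.
move=> /forall_inP mS v a b eva evb ab.
have /forall_inP/(_ _ (mem_edges evb)) := mS _ (mem_edges eva).
have -> : [set v; a] != [set v; b].
  apply: contraNneq ab => /setP/(_ a); rewrite !inE eqxx orbT eq_sym (negPf (edge_neq eva)).
  by move/esym=> /eqP->.
move=> /exists_inP[s sS dab].
exists s => //; apply: contraNT dab; rewrite negb_or => /andP[sa sb].
by rewrite !edge_dist2 !(notin_branchE _ sa, notin_branchE _ sb).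
Qed.

Lemma hits_metric_generator S : hits_branches S -> S != set0 -> metric_generator e S.
Proof.
move=> hS S0; apply/forallP=> x; apply/forallP=> y; apply/implyP=> xy.
have [p [ep sp lp _]] := simple_path_between x y.
have p0 : 1 < size (x :: p) by case: p lp {ep sp} xy => //= ->; rewrite eqxx.
have [s sS [m [mp V mE]]] := middle_branch x hS S0 sp p0.
apply/exists_inP; exists s => //; apply/negP => /eqP.
have := V 0 isT; have := V (size p) (leqnn _); rewrite /= -last_nth /= lp.
by move: mp mE => /=; lia.
Qed.

(** Choose the ends u of A and x of B at the largest distance from each other.
    The geodesic from u to x starts towards the only neighbour of u closer to x,
    which is the other end of A, and likewise it arrives through B. *)
Lemma edges_path A B : A \in edges e -> B \in edges e -> A != B ->
  exists x0 p, [/\ simple_path e p, 2 < size p, A = [set nth x0 p 0; nth x0 p 1]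
    & B = [set nth x0 p (size p).-2; nth x0 p (size p).-1]].
Proof.
move=> /edgesP[u [w [euw Auw]]] /edgesP[x [y [exy Bxy]]] AB.
wlog wx : u w euw Auw / d x w < d x u.
  move=> W; case: (gdist_adj x euw) => E; first by apply: (W u w) => //; rewrite E.
  by apply: (W w u); rewrite 1?tree_sym 1?setUC // E.
wlog [wx' yu] : x y u w exy Bxy euw Auw wx / d x w < d x u /\ d u y < d u x.
  move=> W; case: (gdist_adj u exy) => E; first by apply: (W x y u w) => //; rewrite E.
  have yw : d y w < d y u.
    move: wx E (gdist_adj w exy); rewrite !(gdist_sym y) !(gdist_sym x); lia.
  by apply: (W y x u w) => //; [rewrite tree_sym | rewrite setUC | rewrite E].
have [p [ep sp lp sz]] := simple_path_between u x.
have ux : u != x by apply: contraTneq wx => ->; rewrite gdistxx.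
case: p ep sp lp sz => [_ _ /= lp|w' p]; first by rewrite lp eqxx in ux.
rewrite /= => /andP[euw' ep] sp lp sz.
have w'w : w' = w.
  apply: (@closer_neighbour_unique x u) => //.
  by rewrite !(gdist_sym x) -sz -lp ltnS gdist_walk.
subst w'.
case/lastP: p ep sp lp sz => [_ _ /= wE|p z].
  move=> _; case/eqP: AB; rewrite Auw Bxy -wE setUC.
  suff -> : y = u by [].
  apply/eqP; rewrite eq_sym -(gdist_eq0 (tree_connect _ _)).
  by move: yu; rewrite -wE; have := gdist_step u euw; rewrite gdistxx; lia.
rewrite rcons_path last_rcons size_rcons => /andP[ep ez] sp zx sz; subst z.
have yE : last w p = y.
  apply: (@closer_neighbour_unique u x) => //; first by rewrite tree_sym.
  by rewrite -sz !ltnS; have := @gdist_walk u (w :: p); rewrite /= euw; apply.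
exists u, (u :: w :: rcons p x); rewrite /= size_rcons; split=> //=.
by rewrite nth_rcons ltnn eqxx Bxy -yE -rcons_cons nth_rcons /= ltnSn -last_nth setUC.
Qed.

Lemma hits_edge_metric_generator S :
  hits_branches S -> S != set0 -> edge_metric_generator e S.
Proof.
move=> hS S0; apply/forall_inP=> A Ae; apply/forall_inP=> B Be; apply/implyP=> AB.
have [x0 [p [sp p2 -> ->]]] := edges_path Ae Be AB.
have [s sS [m [mp V mE]]] := middle_branch x0 hS S0 sp (ltnW p2).
apply/exists_inP; exists s => //; rewrite !edge_dist2.
have l0 : 0 < size p by lia.
have l1 : 1 < size p by lia.
have l2 : (size p).-2 < size p by lia.
have l3 : (size p).-1 < size p by lia.
by have := V _ l0; have := V _ l1; have := V _ l2; have := V _ l3; lia.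
Qed.

(** * Bridges *)

(** The bridge at v containing the edge va: one end in the branch is enough, as
    the other end is then in the branch or equal to v. *)
Definition branch_edges (v a : T) : {set {set T}} :=
  [set A in edges e | [exists x in A, x \in branch v a]].

Lemma branch_edgesP v a A :
  reflect (exists x y, [/\ e x y, A = [set x; y] & y \in branch v a])
          (A \in branch_edges v a).
Proof.
rewrite inE; apply: (iffP andP) => [[/edgesP[x [y [exy ->]]] /exists_inP[z]]|[x [y [exy -> yb]]]].
  rewrite in_set2 => /orP[] /eqP-> zb; last by exists x, y.
  by exists y, x; split=> //; [rewrite tree_sym | rewrite setUC].
by split; [apply: mem_edges | apply/exists_inP; exists y; rewrite // set22].
Qed.

Lemma mem_branch_edges v a x y : e v a -> e x y -> y != v ->
  ([set x; y] \in branch_edges v a) = (y \in branch v a).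
Proof.
move=> eva exy yv; apply/idP/idP => [|yb]; last by apply/branch_edgesP; exists x, y.
rewrite inE => /andP[_ /exists_inP[z]]; rewrite in_set2 => /orP[] /eqP-> //.
exact: branch_closed.
Qed.

Lemma branch_edges_exists v A : A \in edges e -> exists2 a, e v a & A \in branch_edges v a.
Proof.
case/edgesP=> x [y [exy ->]].
have [yv|yv] := eqVneq y v; last first.
  by have [a eva ya] := branch_exists yv; exists a; rewrite ?mem_branch_edges.
have [a eva ya] := branch_exists (edge_neq exy); exists a; first by rewrite -yv.
by rewrite setUC mem_branch_edges -?yv ?edge_neq // tree_sym.
Qed.

Lemma branch_edges_unique v a b A : e v a -> e v b ->
  A \in branch_edges v a -> A \in branch_edges v b -> a = b.
Proof.
move=> eva evb /branch_edgesP[x [y [exy -> ya]]].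
have yv : y != v by apply: contraTneq ya => ->; apply: notin_branch.
by rewrite mem_branch_edges //; apply: branch_unique.
Qed.

(** Consecutive edges of a path share a vertex, and as long as it is not v both
    lie in the bridge determined by that vertex. *)
Lemma path_edges_same_branch v a x0 s l r : e v a -> simple_path e s ->
    l <= r -> r.+1 < size s -> (forall j, l < j <= r -> nth x0 s j != v) ->
  ([set nth x0 s l; nth x0 s l.+1] \in branch_edges v a) =
  ([set nth x0 s r; nth x0 s r.+1] \in branch_edges v a).
Proof.
move=> eva /andP[/(sortedP x0) es _]; elim: r => [|r IH].
  by rewrite leqn0 => /eqP->.
rewrite leq_eqVlt => /orP[/eqP-> //|lr] rs nov.
rewrite IH //; [|by lia|by move=> j jr; apply: nov; lia].
have nr : nth x0 s r.+1 != v by apply: nov; lia.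
rewrite mem_branch_edges //; last by apply: es; lia.
by rewrite [in RHS]setUC mem_branch_edges // tree_sym; apply: es.
Qed.

(** The edges of a path without v in its interior all lie in one bridge.
    Conversely, suppose that the path with first edge A and last edge B had v as
    an internal vertex; the edges before v would lie in the bridge of the
    neighbour preceding v, those after v in the bridge of the one following it,
    and these two neighbours are different. *)
Lemma same_bridgeE v a A B : e v a -> A \in branch_edges v a -> B \in edges e ->
  same_bridge e v A B = (B \in branch_edges v a).
Proof.
move=> eva Aa Be; apply/same_bridgeP/idP => [[s [ps]]|Ba].
  case: s ps => // x0 s ps /(path_edgesP x0)[i si AE] /(path_edgesP x0)[j sj BE] vs.
  have eq_ij l r : l <= r -> r.+1 < size (x0 :: s) ->
    ([set nth x0 (x0 :: s) l; nth x0 (x0 :: s) l.+1] \in branch_edges v a) =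
    ([set nth x0 (x0 :: s) r; nth x0 (x0 :: s) r.+1] \in branch_edges v a).
    move=> lr rs; apply: path_edges_same_branch => // k kr.
    apply: contraNneq vs => kv; apply/(internal_verticesP x0); exists k => //; lia.
  rewrite AE in Aa; rewrite BE.
  by have [ij|ji] := leqP i j; [rewrite -(eq_ij i) | rewrite (eq_ij j i) // ltnW].
have [AB|AB] := eqVneq A B.
  subst B; have [x [y [exy AE]]] := edgesP _ Be.
  exists [:: x; y]; rewrite /simple_path /= !inE exy AE eqxx; split=> //.
  by rewrite /= edge_neq.
have Ae : A \in edges e by move: Aa; rewrite inE => /andP[].
have [x0 [s [sp s2 AE BE]]] := edges_path Ae Be AB.
exists s; split=> //.
- by apply/(path_edgesP x0); exists 0 => //; lia.
- by apply/(path_edgesP x0); exists (size s).-2; [lia|rewrite BE; congr [set _; nth x0 s _]; lia].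
apply/negP=> /(internal_verticesP x0)[i /andP[i0 si] iv].
have /andP[/(sortedP x0) es us] := sp.
have si' : i < size s by lia.
(* No other position of the path holds v, so each of the two parts of the path
   stays in one bridge. *)
have nov j : j < size s -> j != i -> nth x0 s j != v.
  by move=> js ji; rewrite -iv nth_uniq.
have ev1 : e v (nth x0 s i.-1).
  by rewrite -iv tree_sym; have := es i.-1; rewrite prednK //; apply; lia.
have ev2 : e v (nth x0 s i.+1) by rewrite -iv; apply: es; lia.
have /eqP : nth x0 s i.-1 = nth x0 s i.+1.
  rewrite AE in Aa; rewrite BE in Ba.
  apply: (@etrans _ _ a).
    apply/esym; apply: (branch_edges_unique eva ev1 Aa).
    rewrite (path_edges_same_branch (r := i.-1)) //.
    - by rewrite prednK // iv setUC mem_branch_edges ?branch_root // eq_sym edge_neq.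
    - by lia.
    - by move=> j ji; apply: nov; lia.
  apply: (branch_edges_unique eva ev2 Ba).
  have -> : (size s).-1 = (size s).-2.+1 by lia.
  rewrite -(path_edges_same_branch (l := i)) //.
  - by rewrite iv mem_branch_edges ?branch_root // eq_sym edge_neq.
  - by lia.
  - by lia.
  - by move=> j ji; apply: nov; lia.
have [li li2] : i.-1 < size s /\ i.+1 < size s by lia.
rewrite nth_uniq //; lia.
Qed.

Lemma bridgesE v : bridges e v = branch_edges v @: neighbours v.
Proof.
have classE a A : e v a -> A \in branch_edges v a ->
    [set B in edges e | same_bridge e v A B] = branch_edges v a.
  move=> eva Aa; apply/setP=> B; rewrite in_set.
  have [Be|Be] /= := boolP (B \in edges e); first exact: same_bridgeE.
  by apply/esym/negbTE; apply: contra Be; rewrite inE => /andP[].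
apply/setP=> X; apply/imsetP/imsetP => [[A Ae ->]|[a]].
  have [a eva Aa] := branch_edges_exists v Ae.
  by exists a; [rewrite inE | apply: classE].
rewrite inE => eva ->; exists [set v; a]; first exact: mem_edges.
rewrite (classE a) // mem_branch_edges ?branch_root //.
by rewrite eq_sym edge_neq.
Qed.

(** * Legs *)

(** Stated by degrees rather than by paths; leg_is_path_graph shows that this is
    the same as the bridge at v through a being a path. *)
Definition leg (v a : T) : bool := [forall x in branch v a, #|neighbours x| <= 2].

(** Since a has degree at most 2, at most one branch at a leads away from v; it
    is again a leg, and v, a is put in front of the path listing it. *)
Lemma leg_path n v a : #|branch v a| <= n -> e v a -> leg v a ->
  exists p, [/\ uniq (a :: p), {subset a :: p <= branch v a}
              & [set A in path_edges [:: v, a & p]] = branch_edges v a].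
Proof.
elim: n v a => [|n IH] v a le_n eva /forall_inP lva.
  by move: le_n; rewrite leqn0 cards_eq0 => /eqP B0; have := branch_root eva; rewrite B0 inE.
have eav : e a v by rewrite tree_sym.
have av : a != v := edge_neq eav.
case: (pickP [pred b | e a b && (b != v)]) => [b /andP[eab bv]|nob].
  have only_b c : e a c -> c != v -> c = b.
    move=> eac cv; apply/eqP; apply: contraT => cb.
    have := lva a (branch_root eva); rewrite leqNgt => /negP[].
    apply: (@leq_trans #|[set v; b; c]|).
      by rewrite -setUA cardsU1 cards2 in_set2 negb_or eq_sym bv eq_sym cv eq_sym cb.
    apply/subset_leq_card/subsetP=> z; rewrite in_setU in_set2 in_set1 in_set.
    by move=> /orP[/orP[]|] /eqP->.
  have sub := branch_sub eva eab bv.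
  have [|//||p [up sp Ep]] := IH a b.
  - by have := proper_card sub; lia.
  - apply/forall_inP=> x xb; apply: lva; move: xb; apply/subsetP; exact: proper_sub sub.
  have subp x : x \in b :: p -> x \in branch v a.
    by move/sp; apply/subsetP; apply: proper_sub sub.
  exists (b :: p); split.
  - by rewrite cons_uniq up andbT; apply/negP=> /sp; apply/negP; apply: notin_branch.
  - by move=> x; rewrite inE => /orP[/eqP->|/subp //]; apply: branch_root.
  apply/setP=> A; rewrite inE -[path_edges _]/([set v; a] :: path_edges [:: a, b & p]) in_cons.
  have -> : (A \in path_edges [:: a, b & p]) = (A \in branch_edges a b) by rewrite -Ep in_set.
  apply/orP/idP => [[/eqP->|]|].
  - by rewrite mem_branch_edges ?branch_root.
  - case/branch_edgesP=> x [y [exy -> yb]]; apply/branch_edgesP; exists x, y; split=> //.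
    by move: yb; apply/subsetP; apply: proper_sub sub.
  case/branch_edgesP=> x [y [exy -> yb]]; move: yb; rewrite branch_rec // => /orP[/eqP ya|].
    have [->|xv] := eqVneq x v; first by left; rewrite ya.
    right; rewrite ya tree_sym in exy *; rewrite (only_b _ exy xv) setUC.
    by rewrite mem_branch_edges ?branch_root // eq_sym edge_neq.
  case/existsP=> c /and3P[eac cv yc]; right; apply/branch_edgesP; exists x, y; split=> //.
  by rewrite -(only_b c).
exists [::]; split=> // [x|]; first by rewrite inE => /eqP->; apply: branch_root.
apply/setP=> A; rewrite in_set -[path_edges _]/[:: [set v; a]] mem_seq1.
apply/eqP/branch_edgesP => [->|[x [y [exy -> yb]]]].
  by exists v, a; split=> //; apply: branch_root.
move: yb; rewrite branch_rec // => /orP[/eqP ya|/existsP[b /and3P[eab bv _]]]; last first.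
  by have := nob b; rewrite /= eab bv.
by subst y; have := nob x; rewrite /= tree_sym exy /=; case: eqP => // ->.
Qed.

(** All edges at a vertex of the branch belong to the bridge, so if the bridge is
    a path, then the degree in the tree is the degree in that path. *)
Lemma leg_is_path_graph v a : e v a ->
  is_path_graph (cover (branch_edges v a)) (branch_edges v a) = leg v a.
Proof.
move=> eva; apply/is_path_graphP/idP => [[s [_ us _ Es]]|lva].
  apply/forall_inP=> x xb; apply: leq_trans (path_degree x us).
  apply/subset_leq_card/subsetP=> y; rewrite !inE => exy.
  suff : [set x; y] \in branch_edges v a by rewrite -Es in_set.
  by rewrite setUC; apply/branch_edgesP; exists y, x; rewrite tree_sym.
have [p [up sp Ep]] := leg_path (leqnn _) eva lva.
exists [:: v, a & p]; split=> //; last by rewrite -Ep cover_path_edges.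
by rewrite cons_uniq up andbT; apply/negP=> /sp; apply/negP; apply: notin_branch.
Qed.

Definition leg_roots (v : T) : {set T} := [set a | e v a & leg v a].

(** Distinct neighbours of v give distinct bridges. *)
Lemma num_legsE v : num_legs e v = #|leg_roots v|.
Proof.
rewrite /num_legs; have -> : legs e v = branch_edges v @: leg_roots v.
  apply/setP=> X; rewrite inE bridgesE; apply/andP/imsetP => [[/imsetP[a]]|[a]].
    by rewrite inE => eva ->; rewrite leg_is_path_graph // => lva; exists a; rewrite ?inE ?eva.
  rewrite inE => /andP[eva lva] ->; rewrite leg_is_path_graph //; split=> //.
  by apply/imsetP; exists a; rewrite ?inE.
apply: card_in_imset => a b; rewrite !inE => /andP[eva _] /andP[evb _] E.
apply: (branch_edges_unique eva evb (A := [set v; a])); last rewrite -E.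
  by rewrite mem_branch_edges ?branch_root // eq_sym edge_neq.
by rewrite mem_branch_edges ?branch_root // eq_sym edge_neq.
Qed.

(** A vertex u as far as possible from x is a leaf, by uniqueness of the closer
    neighbour w.  So the only bridge at u is the whole tree, and if all degrees
    were at most 2 it would be a leg, hence a path. *)
Lemma branching_vertex : ~~ is_path_graph [set: T] (edges e) ->
  forall x y, e x y -> exists v, 2 < #|neighbours v|.
Proof.
move=> not_path x y exy; apply/existsP; apply: contraR not_path => /existsPn deg2.
have [u _ max_u] := @arg_maxnP _ x xpredT (d x) isT.
have xu : x != u.
  apply: contraTneq exy => ux; apply/negP=> /edge_neq/gdist_gt0.
  by have := max_u y isT; rewrite -ux gdistxx; lia.
have [w euw _] := gdist_prev xu.
have only_w w' : e u w' -> w' = w.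
  have lt z : e u z -> d x z < d x u.
    by move=> euz; case: (gdist_adj x euz) => [->//|E]; have := max_u z isT; rewrite /= E ltnn.
  by move=> euw'; apply: (@closer_neighbour_unique x u) => //; apply: lt.
have lw : leg u w by apply/forall_inP=> z _; rewrite leqNgt.
have all_edges : branch_edges u w = edges e.
  apply/eqP; rewrite eqEsubset; apply/andP; split; apply/subsetP=> A.
    by rewrite inE => /andP[].
  by case/(branch_edges_exists u)=> w' /only_w ->.
have := leg_is_path_graph euw; rewrite lw all_edges.
suff -> : cover (edges e) = [set: T] by [].
apply/setP=> z; rewrite inE; apply/bigcupP.
have [->|zu] := eqVneq z u; first by exists [set u; w]; rewrite ?mem_edges ?set21.
rewrite eq_sym in zu; have [c ezc _] := gdist_prev zu.
by exists [set z; c]; rewrite ?mem_edges ?set21.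
Qed.

(** * Generators of a tree which is not a path *)

(** At a vertex with two neighbours the empty set misses two branches. *)
Lemma hits_nonempty (S : {set T}) (x y : T) : ~~ is_path_graph [set: T] (edges e) ->
  hits_branches S -> x != y -> S != set0.
Proof.
move=> not_path hS /gdist_prev[z eyz _].
have [v deg_v] := branching_vertex not_path eyz.
have /card_gt1P[a [b [+ + ab]]] := ltnW deg_v; rewrite !inE => eva evb.
by have [s sS _] := hS v a b eva evb ab; apply/set0Pn; exists s.
Qed.

Lemma metric_generatorP S : ~~ is_path_graph [set: T] (edges e) ->
  reflect (hits_branches S) (metric_generator e S).
Proof.
move=> not_path; apply: (iffP idP); first exact: metric_generator_hits.
move=> hS; apply/forallP=> x; apply/forallP=> y; apply/implyP=> xy.
have := hits_metric_generator hS (hits_nonempty not_path hS xy).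
by move=> /forallP/(_ x)/forallP/(_ y)/implyP/(_ xy).
Qed.

Lemma edge_metric_generatorP S : ~~ is_path_graph [set: T] (edges e) ->
  reflect (hits_branches S) (edge_metric_generator e S).
Proof.
move=> not_path; apply: (iffP idP); first exact: edge_metric_generator_hits.
move=> hS; apply/forall_inP=> A Ae; case/edgesP: (Ae) => x [y [exy _]].
have := hits_edge_metric_generator hS (hits_nonempty not_path hS (edge_neq exy)).
by move=> /forall_inP/(_ A Ae).
Qed.

(** * The minimum size of a generator *)

(** If v had degree 2 with both branches legs, then no vertex at all would have
    degree 3, contradicting the existence of a branching vertex. *)
Lemma leg_roots_degree v : ~~ is_path_graph [set: T] (edges e) ->
  1 < #|leg_roots v| -> 2 < #|neighbours v|.
Proof.
move=> not_path legs2; rewrite ltnNge; apply/negP=> deg_v.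
have sub : leg_roots v \subset neighbours v.
  by apply/subsetP=> a; rewrite !inE => /andP[].
have /eqP eq_v : leg_roots v == neighbours v by rewrite eqEcard sub (leq_trans deg_v).
have /card_gt1P[a [b [+ _ _]]] := legs2; rewrite !inE => /andP[eva _].
have [x] := branching_vertex not_path eva; rewrite ltnNge => /negP[].
have [->//|/branch_exists[c evc xc]] := eqVneq x v.
have : c \in leg_roots v by rewrite eq_v inE.
by rewrite inE => /andP[_ /forall_inP/(_ x xc)].
Qed.

(** Neither origin lies on the other leg, because interior vertices and the end
    of a leg have degree at most 2.  Walking from a common vertex s to a inside
    the first leg never meets w, so it stays inside the second one; the next
    step leads to v, which would then also lie on the second leg. *)
Lemma legs_disjoint v w a b s :
    a \in leg_roots v -> b \in leg_roots w ->
    2 < #|neighbours v| -> 2 < #|neighbours w| ->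
  s \in branch v a -> s \in branch w b -> v = w.
Proof.
rewrite ![_ \in leg_roots _]in_set => /andP[eva lva] /andP[ewb lwb] deg_v deg_w sa sb.
apply/eqP; apply: contraT => vw.
have w_out : w \notin branch v a.
  by apply/negP=> /(forall_inP lva); rewrite leqNgt deg_w.
have v_out : v \notin branch w b.
  by apply/negP=> /(forall_inP lwb); rewrite leqNgt deg_v.
have step x y : avoid v x y ->
    x \in branch v a :&: branch w b -> y \in branch v a :&: branch w b.
  case/and3P=> exy xv yv /setIP[xa xb].
  have ya := branch_closed eva exy yv xa; rewrite in_setI ya (branch_closed ewb exy) //.
  by apply: contraNneq w_out => <-.
have /setIP[_ ab] : a \in branch v a :&: branch w b.
  have clo : closed (avoid v) (mem (branch v a :&: branch w b)).
    by apply: intro_closed; [exact: avoid_sym | exact: step].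
  have /(closed_connect clo) : connect (avoid v) a s by rewrite -branchE.
  by move=> /= ->; rewrite in_setI sa sb.
by case/negP: v_out; apply: (branch_closed ewb _ vw ab); rewrite tree_sym.
Qed.

Definition leg_hits (S : {set T}) (v : T) : {set T} :=
  [set s in S | [exists a in leg_roots v, s \in branch v a]].

(** Picking an element of S in each leg that S meets is injective, and at most
    one leg is missed. *)
Lemma leg_hits_card S v : hits_branches S -> #|leg_roots v| - 1 <= #|leg_hits S v|.
Proof.
move=> hS; pose f a := odflt v [pick s in S :&: branch v a].
pose miss := [set a in leg_roots v | f a \notin S :&: branch v a].
have fP a s : s \in S -> s \in branch v a -> f a \in S :&: branch v a.
  by move=> sS sa; rewrite /f; case: pickP => //= /(_ s); rewrite inE sS sa.
have miss1 : #|miss| <= 1.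
  apply/card_le1_eqP=> a b; rewrite !inE -!andbA => /and3P[eva _ ma] /and3P[evb _ mb].
  apply/eqP; rewrite eq_sym; apply: contraT => ab.
  have [s sS /orP[] sab] := hS v a b eva evb ab.
    by have := fP _ _ sS sab; rewrite !inE => /andP[fS fa]; rewrite fS fa in ma.
  by have := fP _ _ sS sab; rewrite !inE => /andP[fS fa]; rewrite fS fa in mb.
have hit a : a \in leg_roots v :\: miss ->
    [/\ e v a, a \in leg_roots v & f a \in S :&: branch v a].
  rewrite !in_setD in_set => /andP[+ al]; rewrite al /= negbK => fa.
  by move: (al); rewrite inE => /andP[].
apply: (@leq_trans #|leg_roots v :\: miss|).
  rewrite cardsD; have := subset_leq_card (subsetIr (leg_roots v) miss); lia.
rewrite -(@card_in_imset _ _ f).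
  apply/subset_leq_card/subsetP=> _ /imsetP[a /hit[_ al /setIP[fS fa]] ->].
  by rewrite inE fS; apply/exists_inP; exists a.
move=> a b /hit[eva _ /setIP[_ fa]] /hit[evb _ /setIP[_ fb]] fE.
by apply: (branch_unique eva evb fa); rewrite fE.
Qed.

(** By disjointness of the legs, each element of S is counted at most once. *)
Lemma hits_lower_bound S : ~~ is_path_graph [set: T] (edges e) -> hits_branches S ->
  \sum_(v | 1 < num_legs e v) (num_legs e v - 1) <= #|S|.
Proof.
move=> not_path hS.
apply: (@leq_trans (\sum_(v | 1 < num_legs e v) #|leg_hits S v|)).
  by apply: leq_sum => v _; rewrite num_legsE leg_hits_card.
under eq_bigr do rewrite -sum1_card.
rewrite (exchange_big_dep (mem S)) /=; last by move=> v s _; rewrite inE => /andP[].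
rewrite -sum1_card; apply: leq_sum => s sS.
rewrite sum1dep_card; apply/card_le1_eqP => v w; rewrite !inE sS /= !num_legsE.
move=> /andP[lv /exists_inP[a av sa]] /andP[lw /exists_inP[b bw sb]].
by apply: (legs_disjoint bw av _ _ sb sa); apply: leg_roots_degree.
Qed.

(** All leg neighbours of v but one; which one is dropped does not matter. *)
Definition chosen_roots (v : T) : {set T} :=
  leg_roots v :\ odflt v [pick a in leg_roots v].

Lemma chosen_roots_card v : 1 < num_legs e v -> #|chosen_roots v| = num_legs e v - 1.
Proof.
rewrite num_legsE => lv; rewrite /chosen_roots; case: pickP => [a al|none] /=.
  by rewrite [in RHS](cardsD1 a) al addKn.
by move: lv; rewrite (eq_card0 none).
Qed.

Lemma chosen_rootsP v a b : a \in leg_roots v -> b \in leg_roots v -> a != b ->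
  (a \in chosen_roots v) || (b \in chosen_roots v).
Proof.
move=> al bl ab; rewrite !in_setD1 al bl !andbT -negb_and.
by apply: contra ab => /andP[/eqP-> /eqP->].
Qed.

Definition chosen : {set T} := \bigcup_(v | 1 < num_legs e v) chosen_roots v.

Lemma chosen_legs v a b : a \in leg_roots v -> b \in leg_roots v -> a != b ->
  (a \in chosen) || (b \in chosen).
Proof.
move=> al bl ab.
have lv : 1 < num_legs e v by rewrite num_legsE; apply/card_gt1P; exists a, b.
have sub := subsetP (bigcup_sup v lv : chosen_roots v \subset chosen).
by case/orP: (chosen_rootsP al bl ab) => /sub ->; rewrite ?orbT.
Qed.

(** By induction on the size of the branch.  If some smaller branch at a away from
    v is not a leg, the chosen set already meets that one.  Otherwise the only
    vertex of the branch that can have degree 3 or more is a itself, so at least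
    two legs at a lead away from v, and one of their first vertices is chosen. *)
Lemma chosen_hits_nonleg n v a : #|branch v a| <= n -> e v a -> ~~ leg v a ->
  exists2 s, s \in chosen & s \in branch v a.
Proof.
elim: n v a => [|n IH] v a le_n eva nl.
  by move: le_n; rewrite leqn0 cards_eq0 => /eqP B0; have := branch_root eva; rewrite B0 inE.
have sub b : e a b -> b != v -> {subset branch a b <= branch v a}.
  by move=> eab bv; apply/subsetP/proper_sub/branch_sub.
case: (pickP [pred b | [&& e a b, b != v & ~~ leg a b]]) => [b /and3P[eab bv nlb]|all_legs].
  have [||//|s sS sb] := IH a b; first by have := proper_card (branch_sub eva eab bv); lia.
    by [].
  by exists s => //; apply: (sub b).
have legs_a b : e a b -> b != v -> b \in leg_roots a.
  by move=> eab bv; have := all_legs b; rewrite /= eab bv inE eab /= => /negbFE.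
have deg_a : 2 < #|neighbours a|.
  rewrite ltnNge; apply: contra nl => deg_a; apply/forall_inP=> x.
  rewrite branch_rec // => /orP[/eqP->//|/existsP[b /and3P[eab bv xb]]].
  by have := legs_a b eab bv; rewrite inE => /andP[_ /forall_inP]; apply.
have : 1 < #|neighbours a :\ v|.
  by move: deg_a; rewrite (cardsD1 v) inE tree_sym eva.
case/card_gt1P=> b [c []]; rewrite !in_setD1 !in_set => /andP[bv eab] /andP[cv eac] bc.
case/orP: (chosen_legs (legs_a b eab bv) (legs_a c eac cv) bc) => sS.
  by exists b => //; apply: (sub b); rewrite ?branch_root.
by exists c => //; apply: (sub c); rewrite ?branch_root.
Qed.

Lemma chosen_hits : hits_branches chosen.
Proof.
move=> v a b eva evb ab.
have [la|nla] := boolP (leg v a); last first.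
  by have [s sS sa] := chosen_hits_nonleg (leqnn _) eva nla; exists s; rewrite ?sa.
have [lb|nlb] := boolP (leg v b); last first.
  by have [s sS sb] := chosen_hits_nonleg (leqnn _) evb nlb; exists s; rewrite ?sb ?orbT.
have al : a \in leg_roots v by rewrite inE eva.
have bl : b \in leg_roots v by rewrite inE evb.
case/orP: (chosen_legs al bl ab) => sS.
  by exists a; rewrite ?branch_root.
by exists b; rewrite ?branch_root ?orbT.
Qed.

Lemma chosen_card : #|chosen| <= \sum_(v | 1 < num_legs e v) (num_legs e v - 1).
Proof.
rewrite -(eq_bigr _ chosen_roots_card) /chosen.
elim/big_rec2: _ => [|v n A _ le_n]; first by rewrite cards0.
by apply: leq_trans (leq_card_setU _ _) _; rewrite leq_add2l.
Qed.

(** Stated for any boolean test P of the condition, so that it applies to both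
    dimensions. *)
Lemma min_hits (P : pred {set T}) : ~~ is_path_graph [set: T] (edges e) ->
    (forall S, reflect (hits_branches S) (P S)) ->
  #|[arg min_(S < [set: T] | P S) #|S| ]| =
  \sum_(v | 1 < num_legs e v) (num_legs e v - 1).
Proof.
move=> not_path PP; case: arg_minnP => [|S /PP hS min_S].
  by apply/PP=> v a b eva _ _; exists a; rewrite ?in_setT ?branch_root.
apply/eqP; rewrite eqn_leq hits_lower_bound // andbT.
by apply: leq_trans chosen_card; apply/min_S/PP/chosen_hits.
Qed.

End Tree.

Theorem mainTheorem8 (T : finType) (e : rel T) (treeT : tree e)
    (not_path : ~~ is_path_graph [set: T] (edges e)) :
  edge_metric_dim e = metric_dim e /\
  metric_dim e = \sum_(v : T | 1 < num_legs e v) (num_legs e v - 1).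
Proof.
have dimE := min_hits treeT not_path (fun S => metric_generatorP treeT S not_path).
have edimE := min_hits treeT not_path (fun S => edge_metric_generatorP treeT S not_path).
by rewrite /edge_metric_dim /metric_dim edimE dimE.
Qed.
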